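(* Let $M_1,M_2$ be smooth manifolds with $m_2=\dim M_2\ge 2$, and let the smooth warped product metric $$\bar g(x,y,t)=g_1(x,t)\oplus\lambda^2(x,t)g_2(y,t),\qquad t\in[0,\bar T),$$ be a solution to the Ricci flow $\frac{\partial}{\partial t}\bar g=-2\,\overline{\mathrm{Ric}}$ on the manifold $M_1\times M_2$. Then the metrics $g_1$ and $g_2$ satisfy the evolution equations $$\frac{\partial}{\partial t}(g_1)_{ij}=-2\,{}^{M_1}\mathrm{Ric}_{ij}+\frac{2m_2}{\lambda}\mathrm{Hess}(\lambda)(\partial_i,\partial_j),$$ $$\frac{\partial}{\partial t}\big(\lambda^2(g_2)_{\alpha\beta}\big)=-2\,{}^{M_2}\mathrm{Ric}_{\alpha\beta}+\big(\Delta_{M_1}\lambda^2+(2m_2-4)|\mathrm{grad}\,\lambda|^2\big)(g_2)_{\alpha\beta}.$$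
   Context: Here $g_1(\cdot,t)$, $g_2(\cdot,t)$ are families of Riemannian metrics on $M_1$, $M_2$, $\lambda(x,t)>0$ is a smooth function of $x\in M_1$ and $t$, and $\bar g(t)=\pi_1^*g_1(t)+(\lambda(\cdot,t)\circ\pi_1)^2\pi_2^*g_2(t)$, where $\pi_i$ are the projections; $\overline{\mathrm{Ric}}$ is the Ricci tensor of $\bar g(t)$. Indices $i,j$ refer to local coordinates $x^i$ on $M_1$ ($\partial_i=\partial/\partial x^i$), and $\alpha,\beta$ to local coordinates $y^\alpha$ on $M_2$. ${}^{M_i}\mathrm{Ric}$ is the Ricci tensor of $g_i(t)$. $\mathrm{Hess}$, $\mathrm{grad}$, $|\cdot|$ and $\Delta_{M_1}=\mathrm{Tr}_{g_1}\mathrm{Hess}$ are taken on $(M_1,g_1(t))$. *)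

(* Defs.v *)
From mathcomp Require Import all_boot all_order all_algebra.
From mathcomp Require Import all_classical all_reals all_analysis.
Set Implicit Arguments.
Unset Strict Implicit.
Unset Printing Implicit Defensive.
Import Order.TTheory GRing.Theory Num.Theory.
Import numFieldNormedType.Exports.
Local Open Scope classical_set_scope.
Local Open Scope ring_scope.

(** * Smooth real functions *)

(* [smooth_on] and [smooth_within] are only used on finite-dimensional [V],
   where the recursion over all directions [v] is the usual class C^k. *)
Fixpoint Ck_on (R : realType) (V : normedModType R) (k : nat) (O : set V)
    (f : V -> R) : Prop :=
  match k with
  | 0 => forall x, O x -> {for x, continuous f}
  | k'.+1 => (forall x, O x -> differentiable f x) /\
             (forall v, Ck_on k' O (fun x => 'D_v f x))
  end.

Definition smooth_on (R : realType) (V : normedModType R) (O : set V)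
    (f : V -> R) : Prop :=
  forall k, Ck_on k O f.

(* Smoothness on an arbitrary subset, through local smooth extensions; it is
   needed at the boundary time t = 0 of [0, T). *)
Definition smooth_within (R : realType) (V : normedModType R) (D : set V)
    (f : V -> R) : Prop :=
  forall x, D x -> exists (O : set V) (F : V -> R),
    [/\ open O, O x, smooth_on O F & forall y, O y -> D y -> F y = f y].

(** * Smooth manifolds *)

(* [cinv] is total; only its values on the image of [cdom] matter. *)
Record chart (R : realType) (M : topologicalType) (n : nat) := Chart {
  cdom : set M;
  cmap : M -> 'rV[R]_n;
  cinv : 'rV[R]_n -> M }.

Definition cimg (R : realType) (M : topologicalType) (n : nat)
  (c : chart R M n) : set 'rV[R]_n := cmap c @` cdom c.

Definition is_chart (R : realType) (M : topologicalType) (n : nat)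
    (c : chart R M n) : Prop :=
  [/\ open (cdom c), open (cimg c),
      forall p, cdom c p -> cinv c (cmap c p) = p,
      forall p, cdom c p -> {for p, continuous (cmap c)} &
      forall x, cimg c x -> {for x, continuous (cinv c)}].

Definition smooth_transition (R : realType) (M : topologicalType) (n : nat)
    (c d : chart R M n) : Prop :=
  forall j : 'I_n,
    smooth_on (cmap c @` (cdom c `&` cdom d))
      (fun x => (cmap d (cinv c x)) ord0 j).

(* [M] with the smooth structure generated by the atlas [A], which is not
   required to be maximal (but may be). Manifolds are nonempty. *)
Definition smooth_manifold (R : realType) (M : topologicalType) (n : nat)
    (A : set (chart R M n)) : Prop :=
  [/\ [set: M] !=set0,
      hausdorff_space M /\ second_countable (T := M),
      forall c, A c -> is_chart c,
      forall p, exists2 c, A c & cdom c p &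
      forall c d, A c -> A d -> smooth_transition c d].

Definition prod_chart (R : realType) (M1 M2 : topologicalType) (m1 m2 : nat)
    (c1 : chart R M1 m1) (c2 : chart R M2 m2) :
    chart R (M1 * M2)%type (m1 + m2) :=
  {| cdom := cdom c1 `*` cdom c2;
     cmap := fun p => row_mx (cmap c1 p.1) (cmap c2 p.2);
     cinv := fun x => (cinv c1 (lsubmx x), cinv c2 (rsubmx x)) |}.

Definition prod_atlas (R : realType) (M1 M2 : topologicalType) (m1 m2 : nat)
    (A1 : set (chart R M1 m1)) (A2 : set (chart R M2 m2)) :
    set (chart R (M1 * M2)%type (m1 + m2)) :=
  [set c | exists2 c1, A1 c1 & exists2 c2, A2 c2 & c = prod_chart c1 c2].

(** * Tangent vectors *)

Definition smooth_at (R : realType) (M : topologicalType) (n : nat)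
    (A : set (chart R M n)) (p : M) (f : M -> R) : Prop :=
  forall c, A c -> cdom c p ->
    exists O : set 'rV[R]_n,
      [/\ open O, O (cmap c p) & smooth_on O (fun x => f (cinv c x))].

(* A tangent vector at [p] is a derivation of the algebra of germs at [p] of
   smooth functions. It is encoded as a functional on all functions, with the
   value 0 on functions that are not smooth at [p], so that two derivations
   are equal if and only if they agree on germs. *)
Definition tvec (R : realType) (M : topologicalType) : Type := (M -> R) -> R.

Definition is_tangent (R : realType) (M : topologicalType) (n : nat)
    (A : set (chart R M n)) (p : M) (v : tvec R M) : Prop :=
  [/\ forall f, ~ smooth_at A p f -> v f = 0,
      forall f h, smooth_at A p f -> (\forall q \near p, f q = h q) -> v f = v h,
      forall a f h, smooth_at A p f -> smooth_at A p h ->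
        v (fun q => a * f q + h q) = a * v f + v h &
      forall f h, smooth_at A p f -> smooth_at A p h ->
        v (fun q => f q * h q) = v f * h p + f p * v h].

(* The differential of [F] at [p]. *)
Definition dmap (R : realType) (N M : topologicalType) (n : nat)
    (A : set (chart R M n)) (F : N -> M) (p : N) (v : tvec R N) : tvec R M :=
  fun f => if `[< smooth_at A (F p) f >] then v (fun q => f (F q)) else 0.

Definition partial (R : realType) (n : nat) (i : 'I_n) (f : 'rV[R]_n -> R)
  (x : 'rV[R]_n) : R := 'D_(delta_mx ord0 i) f x.

Definition coord_vec (R : realType) (M : topologicalType) (n : nat)
    (A : set (chart R M n)) (c : chart R M n) (p : M) (i : 'I_n) : tvec R M :=
  fun f => if `[< smooth_at A p f >]
           then partial i (fun x => f (cinv c x)) (cmap c p) else 0.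

(** * Riemannian metrics *)

(* Values of a metric outside of tangent vectors are irrelevant. *)
Definition metric (R : realType) (M : topologicalType) : Type :=
  M -> tvec R M -> tvec R M -> R.

(* The matrix of components g(d_i, d_j) at [p] in the chart [c]. *)
Definition gcomp (R : realType) (M : topologicalType) (n : nat)
    (A : set (chart R M n)) (g : metric R M) (c : chart R M n) (p : M) : 'M[R]_n :=
  \matrix_(i, j) g p (coord_vec A c p i) (coord_vec A c p j).

Definition gloc (R : realType) (M : topologicalType) (n : nat)
    (A : set (chart R M n)) (g : metric R M) (c : chart R M n) :
    'rV[R]_n -> 'M[R]_n :=
  fun x => gcomp A g c (cinv c x).

Definition riemannian (R : realType) (M : topologicalType) (n : nat)
    (A : set (chart R M n)) (g : metric R M) : Prop :=
  [/\ forall p u v, is_tangent A p u -> is_tangent A p v -> g p u v = g p v u,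
      forall p a u v w,
        is_tangent A p u -> is_tangent A p v -> is_tangent A p w ->
        g p (fun f => a * u f + v f) w = a * g p u w + g p v w,
      forall p u, is_tangent A p u -> u <> (fun=> 0) -> 0 < g p u u &
      forall c i j, A c -> smooth_on (cimg c) (fun x => gloc A g c x i j)].

(* pi_1^* g1 + (lam \o pi_1)^2 pi_2^* g2 *)
Definition warped (R : realType) (M1 M2 : topologicalType) (m1 m2 : nat)
    (A1 : set (chart R M1 m1)) (A2 : set (chart R M2 m2))
    (g1 : metric R M1) (lam : M1 -> R) (g2 : metric R M2) :
    metric R (M1 * M2)%type :=
  fun p u v =>
    g1 p.1 (dmap A1 fst p u) (dmap A1 fst p v) +
    lam p.1 ^+ 2 * g2 p.2 (dmap A2 snd p u) (dmap A2 snd p v).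

(** * Curvature and differential operators in local coordinates *)

(* Here [G] is the matrix of a metric as a function of the coordinates and
   [invmx (G x)] is the matrix of the g^{ij}. *)

(* Gamma^k_{ij} *)
Definition christoffel (R : realType) (n : nat) (G : 'rV[R]_n -> 'M[R]_n)
    (k i j : 'I_n) (x : 'rV[R]_n) : R :=
  2^-1 * \sum_(l < n) invmx (G x) k l *
    (partial i (fun y => G y j l) x + partial j (fun y => G y i l) x
     - partial l (fun y => G y i j) x).

(* The coefficient R_{ijk}^l in R(d_i, d_j) d_k = R_{ijk}^l d_l, where
   R(X, Y) = [nabla_X, nabla_Y] - nabla_[X, Y]. *)
Definition riemann (R : realType) (n : nat) (G : 'rV[R]_n -> 'M[R]_n)
    (l i j k : 'I_n) (x : 'rV[R]_n) : R :=
  partial i (christoffel G l j k) x - partial j (christoffel G l i k) x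
  + \sum_(s < n) (christoffel G l i s x * christoffel G s j k x
                  - christoffel G l j s x * christoffel G s i k x).

(* Ric(Y, Z) is the trace of X |-> R(X, Y) Z; it is positive on spheres. *)
Definition ricci (R : realType) (n : nat) (G : 'rV[R]_n -> 'M[R]_n)
    (j k : 'I_n) (x : 'rV[R]_n) : R :=
  \sum_(i < n) riemann G i i j k x.

Definition hessian (R : realType) (n : nat) (G : 'rV[R]_n -> 'M[R]_n)
    (f : 'rV[R]_n -> R) (i j : 'I_n) (x : 'rV[R]_n) : R :=
  partial i (partial j f) x
  - \sum_(k < n) christoffel G k i j x * partial k f x.

Definition laplacian (R : realType) (n : nat) (G : 'rV[R]_n -> 'M[R]_n)
    (f : 'rV[R]_n -> R) (x : 'rV[R]_n) : R :=
  \sum_(i < n) \sum_(j < n) invmx (G x) i j * hessian G f i j x.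

Definition gradient (R : realType) (n : nat) (G : 'rV[R]_n -> 'M[R]_n)
    (f : 'rV[R]_n -> R) (i : 'I_n) (x : 'rV[R]_n) : R :=
  \sum_(j < n) invmx (G x) i j * partial j f x.

Definition grad_normsq (R : realType) (n : nat) (G : 'rV[R]_n -> 'M[R]_n)
    (f : 'rV[R]_n -> R) (x : 'rV[R]_n) : R :=
  \sum_(i < n) \sum_(j < n) G x i j * gradient G f i x * gradient G f j x.

Definition Ric (R : realType) (M : topologicalType) (n : nat)
    (A : set (chart R M n)) (g : metric R M) (c : chart R M n) (p : M)
    (i j : 'I_n) : R :=
  ricci (gloc A g c) i j (cmap c p).

Definition Hess (R : realType) (M : topologicalType) (n : nat)
    (A : set (chart R M n)) (g : metric R M) (c : chart R M n) (p : M)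
    (f : M -> R) (i j : 'I_n) : R :=
  hessian (gloc A g c) (fun x => f (cinv c x)) i j (cmap c p).

Definition Laplacian (R : realType) (M : topologicalType) (n : nat)
    (A : set (chart R M n)) (g : metric R M) (c : chart R M n) (p : M)
    (f : M -> R) : R :=
  laplacian (gloc A g c) (fun x => f (cinv c x)) (cmap c p).

Definition GradNormSq (R : realType) (M : topologicalType) (n : nat)
    (A : set (chart R M n)) (g : metric R M) (c : chart R M n) (p : M)
    (f : M -> R) : R :=
  grad_normsq (gloc A g c) (fun x => f (cinv c x)) (cmap c p).

(** * Time-dependent objects on [0, T), where T may be infinite *)

Definition time_interval (R : realType) (T : \bar R) : set R :=
  [set t | 0 <= t /\ (t%:E < T)%E].

(* Two-sided for 0 < t < T, one-sided at t = 0. *)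
Definition has_time_derivative (R : realType) (T : \bar R) (f : R -> R)
    (t l : R) : Prop :=
  (f s - f t) / (s - t) @[s --> within (time_interval T) t^'] --> l.

Definition smooth_fun_family (R : realType) (M : topologicalType) (n : nat)
    (A : set (chart R M n)) (T : \bar R) (f : R -> M -> R) : Prop :=
  forall c, A c ->
    smooth_within (cimg c `*` time_interval T)
      (fun z : 'rV[R]_n * R => f z.2 (cinv c z.1)).

Definition smooth_metric_family (R : realType) (M : topologicalType) (n : nat)
    (A : set (chart R M n)) (T : \bar R) (g : R -> metric R M) : Prop :=
  forall c i j, A c ->
    smooth_within (cimg c `*` time_interval T)
      (fun z : 'rV[R]_n * R => gloc A (g z.2) c z.1 i j).

Definition ricci_flow (R : realType) (M : topologicalType) (n : nat)
    (A : set (chart R M n)) (T : \bar R) (g : R -> metric R M) : Prop :=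
  forall c p t i j, A c -> cdom c p -> time_interval T t ->
    has_time_derivative T (fun s => gcomp A (g s) c p i j) t
      (- 2 * Ric A (g t) c p i j).

(* Main.v *)
(* In product coordinates the warped metric is the block matrix G1 + f^2 G2,
   where f is lambda in the chart. Its Christoffel symbols are those of the two
   factors together with
     Gamma^k_ab = - f (grad f)^k (G2)_ab  and  Gamma^c_ib = delta^c_b d_i f / f,
   so that
     Ric_ij = Ric1_ij - (m2 / f) Hess(f)_ij,
     Ric_ab = Ric2_ab - (f div(grad f) + (m2 - 1) |grad f|^2) (G2)_ab,
   and the mixed components of the metric vanish. Since
   Lap(f^2) = 2 f Lap f + 2 |grad f|^2 and div(grad f) = Lap f, the diagonal
   blocks of the Ricci flow equation are the two evolution equations. *)

Require Import Defs.
From mathcomp Require Import all_boot all_order all_algebra.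
From mathcomp Require Import all_classical all_reals all_analysis.
From mathcomp Require Import ring.
Set Implicit Arguments.
Unset Strict Implicit.
Unset Printing Implicit Defensive.
Import Order.TTheory GRing.Theory Num.Theory.
Import numFieldNormedType.Exports.
Local Open Scope classical_set_scope.
Local Open Scope ring_scope.

(** The curvature computation is separated from the manifolds. It concerns invertible, symmetric,
    differentiable matrix functions [G1] and [G2] on open sets [U] and [V] and a nonvanishing [f],
    the block form of [G] being known only over the product of [U] and [V]. Since metrics act on
    derivations, reaching this setting requires that coordinate vectors be tangent, that Gram
    matrices be invertible, and that the projections send a product coordinate vector to a
    coordinate vector or to 0. The step div(grad f) = Lap f hides most of the index work: the Ricci
    trace yields d_i (grad f)^i + Gamma^i_il (grad f)^l, whereas [laplacian] is the metric trace of
    [hessian]. Their agreement expresses that the Levi-Civita connection preserves the metric; in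
    coordinates it comes from the derivative of the inverse matrix. Time enters only through
    difference quotients of matrix entries; every curvature identity is one at a fixed time. *)

Lemma sum_delta (R : pzSemiRingType) n (a : 'I_n) (F : 'I_n -> R) :
  \sum_(d < n) (a == d)%:R * F d = F a.
Proof.
rewrite (bigD1 a)//= eqxx mul1r big1 ?addr0// => d /negbTE.
by rewrite eq_sym => ->; rewrite mul0r.
Qed.

(** * Partial derivatives *)

Section Differentiable.
Context (R : realType) (V : normedModType R).
Implicit Types (f g : V -> R) (O : set V) (x v : V).

Lemma eq_open_derive O f g x v : open O -> O x ->
  (forall y, O y -> f y = g y) -> 'D_v f x = 'D_v g x.
Proof.
move=> oO Ox fg; apply: near_eq_derive.
by apply: filterS (open_nbhs_nbhs (conj oO Ox)) => y /fg.
Qed.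

Lemma eq_open_differentiable O f g x : open O -> O x ->
  (forall y, O y -> f y = g y) -> differentiable f x -> differentiable g x.
Proof.
move=> oO Ox fg df.
(* Near [x] the two functions coincide, so the first-order expansion of [f] is one of [g], and
   uniqueness of the differential concludes. *)
have gE : g \o shift x = cst (g x) + 'd f x +o_ 0 id.
  apply/eqaddoP => e e0; have /eqaddoP/(_ e e0) := diff_locally df.
  have : \forall h \near 0, O (h + x).
    rewrite (near_shift x) /=; near=> z; rewrite sub0r /= subrK.
    by near: z; exact: open_nbhs_nbhs.
  apply: filterS2 => h Oh; rewrite /= !fctE /=.
  by rewrite !fg.
apply/diff_locallyP; rewrite (diff_unique (diff_continuous df) gE); split => //.
exact: diff_continuous.
Unshelve. all: by end_near. Qed.

Lemma differentiable_constr (a : R) x : differentiable (fun _ : V => a) x.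
Proof. exact: (@differentiable_cst R V R a x). Qed.

Lemma differentiable_addr f g x : differentiable f x -> differentiable g x ->
  differentiable (fun y => f y + g y) x.
Proof. exact: differentiableD. Qed.

Lemma differentiable_mulr f g x : differentiable f x -> differentiable g x ->
  differentiable (fun y => f y * g y) x.
Proof. exact: differentiableM. Qed.

Lemma differentiable_bigsum (I : Type) (r : seq I) (P : pred I)
    (F : I -> V -> R) x :
  (forall i, P i -> differentiable (F i) x) ->
  differentiable (fun y => \sum_(i <- r | P i) F i y) x.
Proof.
move=> dF; elim: r => [|i r IH].
  by under eq_fun do [rewrite big_nil]; exact: differentiable_constr.
under eq_fun do [rewrite big_cons]; case: (boolP (P i)) => // Pi.
by apply: differentiable_addr => //; exact: dF.
Qed.

Lemma differentiable_bigprod (I : Type) (r : seq I) (P : pred I)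
    (F : I -> V -> R) x :
  (forall i, P i -> differentiable (F i) x) ->
  differentiable (fun y => \prod_(i <- r | P i) F i y) x.
Proof.
move=> dF; elim: r => [|i r IH].
  by under eq_fun do [rewrite big_nil]; exact: differentiable_constr.
under eq_fun do [rewrite big_cons]; case: (boolP (P i)) => // Pi.
by apply: differentiable_mulr => //; exact: dF.
Qed.

Lemma differentiable_det n (G : V -> 'M[R]_n) x :
  (forall i j, differentiable (fun y => G y i j) x) ->
  differentiable (fun y => \det (G y)) x.
Proof.
move=> dG; apply: differentiable_bigsum => s _.
apply: differentiable_mulr; first exact: differentiable_constr.
exact: differentiable_bigprod.
Qed.

(** By Cramer's rule an entry of the inverse is a cofactor divided by the determinant, both
    polynomial in the entries of [G y]. The rule describes [invmx] only at invertible matrices, so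
    invertibility is asked on a whole neighbourhood. *)
Lemma differentiable_invmx n (G : V -> 'M[R]_n) O x i j :
  open O -> O x -> (forall y, O y -> G y \in unitmx) ->
  (forall i j, differentiable (fun y => G y i j) x) ->
  differentiable (fun y => invmx (G y) i j) x.
Proof.
move=> oO Ox uG dG.
apply: (@eq_open_differentiable O
  (fun y => (\det (G y))^-1 * cofactor (G y) j i)) => //.
  by move=> y Oy; rewrite /invmx uG// !mxE.
apply: differentiable_mulr.
  apply: differentiableV; first exact: differentiable_det.
  by rewrite -unitfE -unitmxE uG.
apply: differentiable_mulr; first exact: differentiable_constr.
apply: differentiable_det => k l.
by under eq_fun do [rewrite !mxE]; exact: dG.
Qed.

Lemma derive_addr f g x v : differentiable f x -> differentiable g x ->
  'D_v (fun y => f y + g y) x = 'D_v f x + 'D_v g x.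
Proof. by move=> df dg; apply: deriveD; exact: diff_derivable. Qed.

Lemma derive_mulr f g x v : differentiable f x -> differentiable g x ->
  'D_v (fun y => f y * g y) x = f x * 'D_v g x + 'D_v f x * g x.
Proof.
move=> df dg; rewrite [X in _ = _ + X]mulrC.
by apply: deriveM; exact: diff_derivable.
Qed.

Lemma derive_cstM (a : R) f x v : differentiable f x ->
  'D_v (fun y => a * f y) x = a * 'D_v f x.
Proof. by move=> df; apply: deriveZ; exact: diff_derivable. Qed.

Lemma derive_invr f x v : f x != 0 -> differentiable f x ->
  'D_v (fun y => (f y)^-1) x = - (f x) ^- 2 * 'D_v f x.
Proof. by move=> fx0 df; apply: deriveV => //; exact: diff_derivable. Qed.

Lemma derive_bigsum (I : Type) (r : seq I) (F : I -> V -> R) x v :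
  (forall i, differentiable (F i) x) ->
  'D_v (fun y => \sum_(i <- r) F i y) x = \sum_(i <- r) 'D_v (F i) x.
Proof.
move=> dF; elim: r => [|i r IH].
  by under eq_fun do [rewrite big_nil]; rewrite big_nil; exact: derive_cst.
under eq_fun do rewrite big_cons.
by rewrite derive_addr ?IH ?big_cons//; exact: differentiable_bigsum.
Qed.

End Differentiable.

(** Along the line through [x] in direction [v], [phi] is affine, so the two difference quotients
    are literally the same function of [h]; hence [f] need not be differentiable. *)
Lemma derive_precomp (R : realType) (V W : normedModType R) (phi : V -> W)
    (psi : V -> W) (f : W -> R) (x v : V) :
  (forall h : R, phi (h *: v + x) = h *: psi v + phi x) ->
  'D_v (fun y => f (phi y)) x = 'D_(psi v) f (phi x).
Proof.
by move=> phiE; rewrite /derive/=; under eq_fun do rewrite phiE.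
Qed.

Lemma partial_const (R : realType) n (r : R) (i : 'I_n) (z : 'rV[R]_n) :
  partial i (fun=> r) z = 0.
Proof. exact: derive_cst. Qed.

Section PartialSplit.
Context (R : realType) (m n : nat).
Implicit Types (x : 'rV[R]_m) (y : 'rV[R]_n).

Lemma partial_lshift (F : 'rV[R]_(m + n) -> R) x y i :
  partial (lshift n i) F (row_mx x y) = partial i (fun u => F (row_mx u y)) x.
Proof.
rewrite /partial (@derive_precomp _ _ _ (fun u => row_mx u y)
  (fun u => row_mx u 0) F)/=.
  congr ('D_ _ F _); apply/rowP => k.
  by case: (split_ordP k) => l ->; rewrite ?row_mxEl ?row_mxEr !mxE eqxx/= eq_shift.
by move=> h; rewrite scale_row_mx scaler0 add_row_mx add0r.
Qed.

Lemma partial_rshift (F : 'rV[R]_(m + n) -> R) x y i :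
  partial (rshift m i) F (row_mx x y) = partial i (fun u => F (row_mx x u)) y.
Proof.
rewrite /partial (@derive_precomp _ _ _ (fun u => row_mx x u)
  (fun u => row_mx 0 u) F)/=.
  congr ('D_ _ F _); apply/rowP => k.
  by case: (split_ordP k) => l ->; rewrite ?row_mxEl ?row_mxEr !mxE eqxx/= eq_shift.
by move=> h; rewrite scale_row_mx scaler0 add_row_mx add0r.
Qed.

End PartialSplit.

(** * Curvature of a warped product in coordinates *)

Section WarpedCoordinates.
Context (R : realType) (m1 m2 : nat) (U : set 'rV[R]_m1) (V : set 'rV[R]_m2)
  (G1 : 'rV[R]_m1 -> 'M[R]_m1) (G2 : 'rV[R]_m2 -> 'M[R]_m2)
  (f : 'rV[R]_m1 -> R) (G : 'rV[R]_(m1 + m2) -> 'M[R]_(m1 + m2)).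
Context (oU : open U) (oV : open V)
  (unitG1 : forall x, U x -> G1 x \in unitmx)
  (unitG2 : forall y, V y -> G2 y \in unitmx)
  (symG1 : forall x i j, U x -> G1 x i j = G1 x j i)
  (symG2 : forall y a b, V y -> G2 y a b = G2 y b a)
  (diffG1 : forall x i j, U x -> differentiable (fun u => G1 u i j) x)
  (diffG2 : forall y a b, V y -> differentiable (fun u => G2 u a b) y)
  (f_neq0 : forall x, U x -> f x != 0)
  (difff : forall x, U x -> differentiable f x)
  (diffdf : forall x i, U x -> differentiable (partial i f) x)
  (GE : forall x y, U x -> V y ->
    G (row_mx x y) = block_mx (G1 x) 0 0 (f x ^+ 2 *: G2 y)).
Implicit Types (x : 'rV[R]_m1) (y : 'rV[R]_m2) (i j k : 'I_m1) (a b c : 'I_m2).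

(** A derivative at a point of the open set [U] sees only nearby values, so an entry may be replaced
    by a formula valid merely over [U] and [V]. All derivatives of [G] and of its Christoffel
    symbols are computed through this lemma and the next. *)
Lemma partial_l (F : 'rV[R]_(m1 + m2) -> R) (F' : 'rV[R]_m1 -> R) x y i :
  U x -> V y -> (forall u, U u -> F (row_mx u y) = F' u) ->
  partial (lshift m2 i) F (row_mx x y) = partial i F' x.
Proof. by move=> Ux Vy FF'; rewrite partial_lshift; exact: eq_open_derive FF'. Qed.

Lemma partial_r (F : 'rV[R]_(m1 + m2) -> R) (F' : 'rV[R]_m2 -> R) x y a :
  U x -> V y -> (forall u, V u -> F (row_mx x u) = F' u) ->
  partial (rshift m1 a) F (row_mx x y) = partial a F' y.
Proof. by move=> Ux Vy FF'; rewrite partial_rshift; exact: eq_open_derive FF'. Qed.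

Lemma differentiable_sqr x : U x -> differentiable (fun u => f u ^+ 2) x.
Proof. by move=> Ux; apply: differentiable_mulr; exact: difff. Qed.

Lemma partial_sqr x i : U x ->
  partial i (fun u => f u ^+ 2) x = 2 * f x * partial i f x.
Proof.
move=> Ux; rewrite /partial (@derive_mulr _ _ f f); [ring|exact: difff..].
Qed.

Lemma G_ll x y i j : U x -> V y ->
  G (row_mx x y) (lshift m2 i) (lshift m2 j) = G1 x i j.
Proof. by move=> Ux Vy; rewrite GE// block_mxEul. Qed.

Lemma G_lr x y i a : U x -> V y -> G (row_mx x y) (lshift m2 i) (rshift m1 a) = 0.
Proof. by move=> Ux Vy; rewrite GE// block_mxEur mxE. Qed.

Lemma G_rl x y i a : U x -> V y -> G (row_mx x y) (rshift m1 a) (lshift m2 i) = 0.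
Proof. by move=> Ux Vy; rewrite GE// block_mxEdl mxE. Qed.

Lemma G_rr x y a b : U x -> V y ->
  G (row_mx x y) (rshift m1 a) (rshift m1 b) = f x ^+ 2 * G2 y a b.
Proof. by move=> Ux Vy; rewrite GE// block_mxEdr mxE. Qed.

Lemma invG x y : U x -> V y -> invmx (G (row_mx x y)) =
  block_mx (invmx (G1 x)) 0 0 (f x ^- 2 *: invmx (G2 y)).
Proof.
move=> Ux Vy; have f0 := f_neq0 Ux; have f20 : f x ^+ 2 != 0 by rewrite expf_neq0.
have uG2 : f x ^+ 2 *: G2 y \in unitmx by rewrite unitmxZ ?unitfE// unitG2.
rewrite GE// invmx_block_diag; last first.
  by rewrite unitmxE det_ublock unitrM -!unitmxE unitG1.
by rewrite invmxZ// ?unitfE.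
Qed.

(** In the names below, the suffix letters l and r tell, index by index and in the order of the
    arguments, whether an index belongs to the first or the second factor. *)
Definition dG (k i j : 'I_(m1 + m2)) (z : 'rV[R]_(m1 + m2)) : R :=
  partial k (fun w => G w i j) z.

Lemma dG_lll x y k i j : U x -> V y ->
  dG (lshift m2 k) (lshift m2 i) (lshift m2 j) (row_mx x y)
  = partial k (fun u => G1 u i j) x.
Proof. by move=> Ux Vy; apply: partial_l => // u Uu; rewrite G_ll. Qed.

Lemma dG_llr x y k i a : U x -> V y ->
  dG (lshift m2 k) (lshift m2 i) (rshift m1 a) (row_mx x y) = 0.
Proof.
move=> Ux Vy; rewrite -(partial_const 0 k x).
by apply: partial_l => // u Uu; rewrite G_lr.
Qed.

Lemma dG_lrl x y k i a : U x -> V y ->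
  dG (lshift m2 k) (rshift m1 a) (lshift m2 i) (row_mx x y) = 0.
Proof.
move=> Ux Vy; rewrite -(partial_const 0 k x).
by apply: partial_l => // u Uu; rewrite G_rl.
Qed.

Lemma dG_lrr x y k a b : U x -> V y ->
  dG (lshift m2 k) (rshift m1 a) (rshift m1 b) (row_mx x y)
  = 2 * f x * partial k f x * G2 y a b.
Proof.
move=> Ux Vy; rewrite -partial_sqr// mulrC.
rewrite -[RHS]derive_cstM; last exact: differentiable_sqr.
by apply: partial_l => // u Uu; rewrite G_rr// mulrC.
Qed.

Lemma dG_rll x y c i j : U x -> V y ->
  dG (rshift m1 c) (lshift m2 i) (lshift m2 j) (row_mx x y) = 0.
Proof.
move=> Ux Vy; rewrite -(partial_const (G1 x i j) c y).
by apply: partial_r => // u Uu; rewrite G_ll.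
Qed.

Lemma dG_rlr x y c i a : U x -> V y ->
  dG (rshift m1 c) (lshift m2 i) (rshift m1 a) (row_mx x y) = 0.
Proof.
move=> Ux Vy; rewrite -(partial_const 0 c y).
by apply: partial_r => // u Uu; rewrite G_lr.
Qed.

Lemma dG_rrl x y c i a : U x -> V y ->
  dG (rshift m1 c) (rshift m1 a) (lshift m2 i) (row_mx x y) = 0.
Proof.
move=> Ux Vy; rewrite -(partial_const 0 c y).
by apply: partial_r => // u Uu; rewrite G_rl.
Qed.

Lemma dG_rrr x y c a b : U x -> V y ->
  dG (rshift m1 c) (rshift m1 a) (rshift m1 b) (row_mx x y)
  = f x ^+ 2 * partial c (fun u => G2 u a b) y.
Proof.
move=> Ux Vy; rewrite -[RHS]derive_cstM; last exact: diffG2.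
by apply: partial_r => // u Uu; rewrite G_rr.
Qed.

Definition dGE := (dG_lll, dG_llr, dG_lrl, dG_lrr, dG_rll, dG_rlr, dG_rrl, dG_rrr).

(** * Christoffel symbols of the warped metric *)

Lemma christoffel_split (p q r : 'I_(m1 + m2)) z :
  christoffel G p q r z = 2^-1 *
    (\sum_(l < m1) invmx (G z) p (lshift m2 l) *
        (dG q r (lshift m2 l) z + dG r q (lshift m2 l) z - dG (lshift m2 l) q r z)
     + \sum_(c < m2) invmx (G z) p (rshift m1 c) *
        (dG q r (rshift m1 c) z + dG r q (rshift m1 c) z - dG (rshift m1 c) q r z)).
Proof. by rewrite /christoffel big_split_ord. Qed.

(** The inverse metric is block diagonal, so raising an index of one factor involves only that
    factor. *)
Lemma christoffel_l x y k (q r : 'I_(m1 + m2)) : U x -> V y ->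
  christoffel G (lshift m2 k) q r (row_mx x y) = 2^-1 *
    \sum_(l < m1) invmx (G1 x) k l *
        (dG q r (lshift m2 l) (row_mx x y) + dG r q (lshift m2 l) (row_mx x y)
         - dG (lshift m2 l) q r (row_mx x y)).
Proof.
move=> Ux Vy; rewrite christoffel_split invG//; congr (_ * _).
rewrite [X in _ + X]big1 ?addr0 => [|c _]; last by rewrite block_mxEur mxE mul0r.
by apply: eq_bigr => l _; rewrite block_mxEul.
Qed.

Lemma christoffel_r x y c (q r : 'I_(m1 + m2)) : U x -> V y ->
  christoffel G (rshift m1 c) q r (row_mx x y) = 2^-1 *
    \sum_(d < m2) f x ^- 2 * invmx (G2 y) c d *
        (dG q r (rshift m1 d) (row_mx x y) + dG r q (rshift m1 d) (row_mx x y)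
         - dG (rshift m1 d) q r (row_mx x y)).
Proof.
move=> Ux Vy; rewrite christoffel_split invG//; congr (_ * _).
rewrite big1 ?add0r => [|l _]; last by rewrite block_mxEdl mxE mul0r.
by apply: eq_bigr => l _; rewrite block_mxEdr mxE.
Qed.

Lemma christoffel_lll x y k i j : U x -> V y ->
  christoffel G (lshift m2 k) (lshift m2 i) (lshift m2 j) (row_mx x y)
  = christoffel G1 k i j x.
Proof.
move=> Ux Vy; rewrite christoffel_l//; congr (_ * _).
by apply: eq_bigr => l _; rewrite !dGE.
Qed.

Lemma christoffel_llr x y k i a : U x -> V y ->
  christoffel G (lshift m2 k) (lshift m2 i) (rshift m1 a) (row_mx x y) = 0.
Proof.
move=> Ux Vy; rewrite christoffel_l// big1 ?mulr0// => l _.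
by rewrite !dGE//; ring.
Qed.

Lemma christoffel_lrl x y k i a : U x -> V y ->
  christoffel G (lshift m2 k) (rshift m1 a) (lshift m2 i) (row_mx x y) = 0.
Proof.
move=> Ux Vy; rewrite christoffel_l// big1 ?mulr0// => l _.
by rewrite !dGE//; ring.
Qed.

(** Of the three derivatives only - d_l (f^2 G2_ab) survives; its factor 2 absorbs the 1/2 in
    front. *)
Lemma christoffel_lrr x y k a b : U x -> V y ->
  christoffel G (lshift m2 k) (rshift m1 a) (rshift m1 b) (row_mx x y)
  = - (f x * gradient G1 f k x) * G2 y a b.
Proof.
move=> Ux Vy; rewrite christoffel_l// /gradient.
rewrite [in RHS]mulr_sumr -sumrN mulr_suml mulr_sumr.
by apply: eq_bigr => l _; rewrite !dGE//; field.
Qed.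

Lemma christoffel_rll x y c i j : U x -> V y ->
  christoffel G (rshift m1 c) (lshift m2 i) (lshift m2 j) (row_mx x y) = 0.
Proof.
move=> Ux Vy; rewrite christoffel_r// big1 ?mulr0// => l _.
by rewrite !dGE//; ring.
Qed.

Lemma invG2_mul y a b : V y ->
  \sum_(d < m2) invmx (G2 y) a d * G2 y d b = (a == b)%:R.
Proof.
by move=> Vy; have /matrixP/(_ a b) := mulVmx (unitG2 Vy); rewrite !mxE.
Qed.

(** Only d_i (f^2 G2_bd) = 2 f (d_i f) G2_bd survives. The f^-2 of the inverse metric leaves d_i f /
    f, and contracting [G2] with its inverse leaves the Kronecker delta. *)
Lemma christoffel_rlr x y c i b : U x -> V y ->
  christoffel G (rshift m1 c) (lshift m2 i) (rshift m1 b) (row_mx x y)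
  = (c == b)%:R * (partial i f x / f x).
Proof.
move=> Ux Vy; have f0 := f_neq0 Ux.
rewrite christoffel_r// -(invG2_mul c b Vy) mulr_suml mulr_sumr.
apply: eq_bigr => d _; rewrite !dGE// (symG2 b d Vy).
by field.
Qed.

Lemma christoffel_rrl x y c i b : U x -> V y ->
  christoffel G (rshift m1 c) (rshift m1 b) (lshift m2 i) (row_mx x y)
  = (c == b)%:R * (partial i f x / f x).
Proof.
move=> Ux Vy; have f0 := f_neq0 Ux.
rewrite christoffel_r// -(invG2_mul c b Vy) mulr_suml mulr_sumr.
apply: eq_bigr => d _; rewrite !dGE// (symG2 b d Vy).
by field.
Qed.

Lemma christoffel_rrr x y c a b : U x -> V y ->
  christoffel G (rshift m1 c) (rshift m1 a) (rshift m1 b) (row_mx x y)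
  = christoffel G2 c a b y.
Proof.
move=> Ux Vy; have f0 := f_neq0 Ux.
rewrite christoffel_r//; congr (_ * _).
by apply: eq_bigr => d _; rewrite !dGE//; field.
Qed.

Definition christoffelE := (christoffel_lll, christoffel_llr, christoffel_lrl,
  christoffel_lrr, christoffel_rll, christoffel_rlr, christoffel_rrl, christoffel_rrr).

(** * Curvature components entering the Ricci trace *)

Lemma riemann_split (p q r s : 'I_(m1 + m2)) z :
  riemann G p q r s z =
    partial q (christoffel G p r s) z - partial r (christoffel G p q s) z
    + (\sum_(l < m1)
         (christoffel G p q (lshift m2 l) z * christoffel G (lshift m2 l) r s z
          - christoffel G p r (lshift m2 l) z * christoffel G (lshift m2 l) q s z)
       + \sum_(d < m2)
         (christoffel G p q (rshift m1 d) z * christoffel G (rshift m1 d) r s z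
          - christoffel G p r (rshift m1 d) z * christoffel G (rshift m1 d) q s z)).
Proof. by rewrite /riemann big_split_ord. Qed.

(** The slices with [y] fixed are totally geodesic, so summation over indices of the second factor
    contributes nothing. *)
Lemma riemann_llll x y i j k l : U x -> V y ->
  riemann G (lshift m2 l) (lshift m2 i) (lshift m2 j) (lshift m2 k) (row_mx x y)
  = riemann G1 l i j k x.
Proof.
move=> Ux Vy; rewrite riemann_split /riemann; congr (_ - _ + _).
- by apply: partial_l => // u Uu; rewrite christoffelE.
- by apply: partial_l => // u Uu; rewrite christoffelE.
rewrite [X in _ + X]big1 ?addr0 => [|d _]; last by rewrite !christoffelE//; ring.
by apply: eq_bigr => s _; rewrite !christoffelE.
Qed.

Lemma partial_dlog x j k : U x ->
  partial j (fun u => partial k f u / f u) x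
  = partial j (partial k f) x / f x - partial k f x * partial j f x / f x ^+ 2.
Proof.
move=> Ux; have f0 := f_neq0 Ux.
rewrite /partial (@derive_mulr _ _ (partial k f) (fun u => (f u)^-1)).
- by rewrite derive_invr//; [rewrite /partial; ring|exact: difff].
- exact: diffdf.
- by apply: differentiableV => //; exact: difff.
Qed.

(** Differentiating d_k f / f produces a term (d_j f)(d_k f) / f^2, which cancels against Gamma^a_ja
    Gamma^a_ak; what remains assembles into the Hessian. The value does not depend on [a], whence
    the factor m2 in the Ricci tensor. *)
Lemma riemann_rrll x y a j k : U x -> V y ->
  riemann G (rshift m1 a) (rshift m1 a) (lshift m2 j) (lshift m2 k) (row_mx x y)
  = - (hessian G1 f j k x / f x).
Proof.
move=> Ux Vy; have f0 := f_neq0 Ux; rewrite riemann_split.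
rewrite (@partial_r _ (fun=> 0)) ?partial_const//; last first.
  by move=> u Vu; rewrite christoffelE.
rewrite (@partial_l _ (fun u => partial k f u / f u)) ?partial_dlog//; last first.
  by move=> u Uu; rewrite christoffelE// eqxx mul1r.
under eq_bigr => l _ do rewrite !christoffelE// eqxx mul1r mul0r subr0.
under [X in _ + (_ + X)]eq_bigr => d _ do
  rewrite !christoffelE// mulr0 sub0r -mulrA -mulrN.
rewrite sum_delta eqxx mul1r /hessian mulrBl mulr_suml.
rewrite (eq_bigr (fun l => christoffel G1 l j k x * partial l f x / f x)); last first.
  by move=> l _; ring.
by field.
Qed.

Lemma ricci_ll x y j k : U x -> V y ->
  ricci G (lshift m2 j) (lshift m2 k) (row_mx x y)
  = ricci G1 j k x - m2%:R / f x * hessian G1 f j k x.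
Proof.
move=> Ux Vy; rewrite /ricci big_split_ord; congr (_ + _).
  by apply: eq_bigr => i _; rewrite riemann_llll.
under eq_bigr => a _ do rewrite riemann_rrll//.
by rewrite sumr_const card_ord -mulr_natl; ring.
Qed.

Lemma differentiable_gradient x k : U x -> differentiable (gradient G1 f k) x.
Proof.
move=> Ux; apply: differentiable_bigsum => j _; apply: differentiable_mulr.
  by apply: (@differentiable_invmx _ _ _ G1 U) => // i l; exact: diffG1.
exact: diffdf.
Qed.

(** The covariant divergence of grad f, kept in the form that the trace of [riemann_llrr] produces;
    [divgradE] identifies it with the Laplacian. *)
Definition divgrad x : R := \sum_(i < m1)
  (partial i (gradient G1 f i) x
   + \sum_(l < m1) christoffel G1 i i l x * gradient G1 f l x).

(** The product rule applied to Gamma^i_bc = - f (grad f)^i G2_bc yields a term in (d_i f)(grad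
    f)^i, which cancels against Gamma^i_bc Gamma^c_ic. The other part is the [i]-th summand of the
    divergence of grad f. *)
Lemma riemann_llrr x y i b c : U x -> V y ->
  riemann G (lshift m2 i) (lshift m2 i) (rshift m1 b) (rshift m1 c) (row_mx x y)
  = - f x * (partial i (gradient G1 f i) x
      + \sum_(l < m1) christoffel G1 i i l x * gradient G1 f l x) * G2 y b c.
Proof.
move=> Ux Vy; have f0 := f_neq0 Ux; rewrite riemann_split.
rewrite (@partial_l _ (fun u => - G2 y b c * (f u * gradient G1 f i u)))//; last first.
  by move=> u Uu; rewrite christoffelE//; ring.
rewrite (@partial_r _ (fun=> 0)) ?partial_const//; last first.
  by move=> u Vu; rewrite christoffelE.
have dfg : differentiable (fun u => f u * gradient G1 f i u) x.
  by apply: differentiable_mulr; [exact: difff|exact: differentiable_gradient].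
rewrite /partial derive_cstM// derive_mulr; last 2 first.
- exact: difff.
- exact: differentiable_gradient.
rewrite -!/(partial _ _ _).
under eq_bigr => l _ do rewrite !christoffelE// mul0r subr0.
under [X in _ + (_ + X)]eq_bigr => d _ do
  rewrite !christoffelE// mul0r sub0r mulrCA -mulrN (eq_sym d).
rewrite sum_delta.
rewrite (eq_bigr (fun l => - f x * G2 y b c *
    (christoffel G1 i i l x * gradient G1 f l x))) => [|l _]; last by ring.
by rewrite -mulr_sumr; field.
Qed.

(** A Gauss equation for the fibres with [x] fixed: the correction comes from the sum over
    first-factor indices, through Gamma^a_al Gamma^l_bc and Gamma^a_bl Gamma^l_ac. Summed over [a]
    it gives (1 - m2) |grad f|^2 G2_bc, the delta term accounting for the 1. *)
Lemma riemann_rrrr x y a b c : U x -> V y ->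
  riemann G (rshift m1 a) (rshift m1 a) (rshift m1 b) (rshift m1 c) (row_mx x y)
  = riemann G2 a a b c y
    + (\sum_(l < m1) partial l f x * gradient G1 f l x)
      * ((b == a)%:R * G2 y a c - G2 y b c).
Proof.
move=> Ux Vy; have f0 := f_neq0 Ux.
rewrite riemann_split /riemann -!addrA; congr (_ + (- _ + _)).
- by apply: partial_r => // u Vu; rewrite christoffelE.
- by apply: partial_r => // u Vu; rewrite christoffelE.
rewrite [LHS]addrC; congr (_ + _).
  by apply: eq_bigr => d _; rewrite !christoffelE.
rewrite mulr_suml; apply: eq_bigr => l _.
by rewrite !christoffelE// eqxx mul1r (eq_sym a); field.
Qed.

Lemma ricci_rr x y b c : U x -> V y ->
  ricci G (rshift m1 b) (rshift m1 c) (row_mx x y)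
  = ricci G2 b c y
    - (f x * divgrad x
       + (m2%:R - 1) * \sum_(l < m1) partial l f x * gradient G1 f l x) * G2 y b c.
Proof.
move=> Ux Vy; rewrite /ricci big_split_ord/=.
under eq_bigr => i _ do rewrite riemann_llrr//.
under [X in _ + X]eq_bigr => a _ do rewrite riemann_rrrr//.
rewrite -mulr_suml -mulr_sumr -/(divgrad x) big_split/= -mulr_sumr sumrB sum_delta.
by rewrite sumr_const card_ord -mulr_natl; ring.
Qed.

(** * The divergence of the gradient as the trace of the Hessian *)

Lemma invG1_mul x i j : U x ->
  \sum_(k < m1) invmx (G1 x) i k * G1 x k j = (i == j)%:R.
Proof.
by move=> Ux; have /matrixP/(_ i j) := mulVmx (unitG1 Ux); rewrite !mxE.
Qed.

Lemma sym_invG1 x i j : U x -> invmx (G1 x) i j = invmx (G1 x) j i.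
Proof.
move=> Ux; have /matrixP/(_ i j) <- : (invmx (G1 x))^T = invmx (G1 x).
  by rewrite trmx_inv; congr invmx; apply/matrixP => k l; rewrite mxE symG1.
by rewrite mxE.
Qed.

(** Since G1^-1 G1 = 1 on all of [U], differentiation gives (d_k G1^-1) G1 + G1^-1 (d_k G1) = 0;
    multiplying by G1^-1 on the right isolates d_k G1^-1. *)
Lemma partial_invG1 x k i j : U x ->
  partial k (fun u => invmx (G1 u) i j) x
  = - \sum_(p < m1) \sum_(q < m1)
      invmx (G1 x) i p * partial k (fun u => G1 u p q) x * invmx (G1 x) q j.
Proof.
move=> Ux.
pose D := \matrix_(p, q) partial k (fun u => G1 u p q) x.
pose E := \matrix_(p, q) partial k (fun u => invmx (G1 u) p q) x.
have dH p q : differentiable (fun u => invmx (G1 u) p q) x.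
  by apply: (@differentiable_invmx _ _ _ G1 U) => // *; exact: diffG1.
have EG : E *m G1 x = - (invmx (G1 x) *m D).
  apply/matrixP => p q; apply/eqP; rewrite !mxE -addr_eq0 addrC -big_split/=.
  have := partial_const (p == q)%:R k x.
  rewrite /partial -(@eq_open_derive _ _ U
    (fun u => \sum_(r < m1) invmx (G1 u) p r * G1 u r q))//; last first.
    by move=> u Uu; rewrite invG1_mul.
  rewrite derive_bigsum => [dHG0|r]; last first.
    by apply: differentiable_mulr => //; exact: diffG1.
  apply/eqP; rewrite -[RHS]dHG0; apply: eq_bigr => r _.
  by rewrite !mxE derive_mulr//; exact: diffG1.
have -> : partial k (fun u => invmx (G1 u) i j) x = E i j by rewrite mxE.
have -> : E = - (invmx (G1 x) *m D *m invmx (G1 x)).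
  by rewrite -mulNmx -EG mulmxK// unitG1.
rewrite !mxE exchange_big/=; congr (- _); apply: eq_bigr => q _.
by rewrite !mxE mulr_suml; apply: eq_bigr => p _; rewrite mxE.
Qed.

Section DivGrad.
Context (x : 'rV[R]_m1) (Ux : U x).
Let H i j := invmx (G1 x) i j.
Let C k i j := partial k (fun u => G1 u i j) x.

Let symH i j : H i j = H j i. Proof. exact: sym_invG1. Qed.

Let symC k i j : C k i j = C k j i.
Proof. by apply: eq_open_derive oU Ux _ => u Uu; rewrite symG1. Qed.

(** The two ways to contract the first derivatives of [G1] with its inverse: [divG] pairs the
    derivative index with a matrix index, while [trdG] pairs the two matrix indices and is the
    logarithmic derivative of the determinant. *)
Let divG l := \sum_(i < m1) \sum_(p < m1) H i p * C i p l.
Let trdG l := \sum_(i < m1) \sum_(p < m1) H i p * C l i p.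

Let christoffelHC k i j : christoffel G1 k i j x =
  2^-1 * \sum_(l < m1) H k l * (C i j l + C j i l - C l i j).
Proof. by []. Qed.

(** By the symmetry of [H] and [C], two of the three derivative terms both contract to [divG l],
    with opposite signs. *)
Lemma contracted_christoffel l :
  \sum_(i < m1) christoffel G1 i i l x = 2^-1 * trdG l.
Proof.
under eq_bigr do rewrite christoffelHC.
rewrite -mulr_sumr; congr (_ * _).
rewrite (_ : trdG l = divG l + trdG l - divG l); last by ring.
rewrite {2}/divG [X in _ = _ - X]exchange_big /divG /trdG -!big_split/= -sumrB.
apply: eq_bigr => i _; rewrite -big_split/= -sumrB; apply: eq_bigr => p _.
by rewrite (symC i l p) (symH p i); ring.
Qed.

(** Here the two positive derivative terms each contract to [divG l], which cancels the 1/2, and the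
    negative one contracts to [trdG l]. *)
Lemma trace_christoffel j :
  \sum_(i < m1) \sum_(k < m1) H i k * christoffel G1 j i k x
  = \sum_(l < m1) (divG l - 2^-1 * trdG l) * H l j.
Proof.
have divG2 l : divG l = \sum_(i < m1) \sum_(p < m1) H i p * C p i l.
  rewrite /divG exchange_big/=; apply: eq_bigr => i _; apply: eq_bigr => p _.
  by rewrite symH.
under [RHS]eq_bigr => l _.
  rewrite (_ : divG l - 2^-1 * trdG l = 2^-1 * (divG l + divG l - trdG l)); last first.
    by field.
  rewrite {2}divG2 /divG /trdG -big_split/= -sumrB mulr_sumr mulr_suml.
  over.
rewrite [RHS]exchange_big/=; apply: eq_bigr => i _.
under [RHS]eq_bigr => l _ do rewrite -big_split/= -sumrB mulr_sumr mulr_suml.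
rewrite [RHS]exchange_big/=; apply: eq_bigr => k _.
rewrite christoffelHC mulrCA mulr_sumr mulr_sumr; apply: eq_bigr => l _.
by rewrite (symH l j); ring.
Qed.

(* Both sides are contractions of d_k (G1)_ij with two factors G1^-1; the
   difference vanishes by the symmetry of G1. This identity turns the coordinate
   divergence of the gradient into the trace of the Hessian. *)
Lemma divergence_invG1 j :
  \sum_(i < m1) (partial i (fun u => invmx (G1 u) i j) x
                 + \sum_(l < m1) christoffel G1 i i l x * H l j)
  = - \sum_(i < m1) \sum_(k < m1) H i k * christoffel G1 j i k x.
Proof.
rewrite trace_christoffel big_split/= [X in _ + X]exchange_big/=.
under [X in _ + X]eq_bigr => l _ do
  rewrite -mulr_suml contracted_christoffel.
under eq_bigr => i _ do rewrite partial_invG1// exchange_big.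
rewrite sumrN exchange_big/= -[RHS]sumrN -sumrN -big_split/=.
apply: eq_bigr => l _; rewrite mulrBl opprB addrC; congr (_ - _).
rewrite /divG mulr_suml; apply: eq_bigr => i _; rewrite mulr_suml.
by [].
Qed.

(** After the product rule, the second derivatives of [f] appear identically on both sides.
    Comparing the coefficients of each d_j f leaves exactly [divergence_invG1]. *)
Lemma divgradE : divgrad x = laplacian G1 f x.
Proof.
rewrite /divgrad /laplacian.
under eq_bigr => i _.
  rewrite {1}/gradient /partial derive_bigsum; last first.
    move=> j; apply: differentiable_mulr; last exact: diffdf.
    by apply: (@differentiable_invmx _ _ _ G1 U) => // *; exact: diffG1.
  under eq_bigr => j _.
    rewrite derive_mulr; last exact: diffdf; last first.
      by apply: (@differentiable_invmx _ _ _ G1 U) => // *; exact: diffG1.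
    over.
  rewrite -!/(partial _ _ _) /gradient.
  under [X in _ + X]eq_bigr do rewrite mulr_sumr.
  rewrite [X in _ + X]exchange_big/= -big_split/=.
  under eq_bigr => j _.
    under [X in _ + X]eq_bigr do rewrite mulrA.
    rewrite -mulr_suml -addrA -mulrDl; over.
  over.
under [RHS]eq_bigr => i _.
  under eq_bigr => j _.
    rewrite /hessian mulrBr mulr_sumr; over.
  rewrite sumrB; over.
under eq_bigr do rewrite big_split/=.
rewrite big_split sumrB/=; congr (_ + _).
rewrite exchange_big/=.
under eq_bigr => j _ do rewrite -mulr_suml divergence_invG1.
under eq_bigr do rewrite mulNr mulr_suml.
rewrite !sumrN exchange_big/=; congr (- _); apply: eq_bigr => i _.
under eq_bigr do rewrite mulr_suml.
rewrite exchange_big/=; apply: eq_bigr => k _.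
by apply: eq_bigr => j _; rewrite -mulrA.
Qed.

Lemma grad_normsqE :
  grad_normsq G1 f x = \sum_(l < m1) partial l f x * gradient G1 f l x.
Proof.
rewrite /grad_normsq; apply: eq_bigr => i _.
under eq_bigr do rewrite mulrAC.
rewrite -mulr_suml; congr (_ * _).
under eq_bigr do rewrite /gradient mulr_sumr.
rewrite exchange_big/=.
under eq_bigr => k _ do under eq_bigr do rewrite mulrA.
under eq_bigr => k _ do rewrite -mulr_suml.
have GH k : \sum_(j < m1) G1 x i j * invmx (G1 x) j k = (i == k)%:R.
  by have /matrixP/(_ i k) := mulmxV (unitG1 Ux); rewrite !mxE.
under eq_bigr do rewrite GH.
by rewrite sum_delta.
Qed.

Lemma hessian_sqr i j :
  hessian G1 (fun u => f u ^+ 2) i j x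
  = 2 * f x * hessian G1 f i j x + 2 * partial i f x * partial j f x.
Proof.
rewrite /hessian mulrBr mulr_sumr addrAC; congr (_ - _).
  rewrite [LHS](@eq_open_derive _ _ U _ (fun u => 2 * (f u * partial j f u)))//;
    last by move=> u Uu; rewrite partial_sqr// mulrA.
  rewrite derive_cstM; last by apply: differentiable_mulr; [exact: difff|exact: diffdf].
  by rewrite derive_mulr; [rewrite /partial; ring|exact: difff|exact: diffdf].
by apply: eq_bigr => k _; rewrite partial_sqr//; ring.
Qed.

Lemma laplacian_sqr :
  laplacian G1 (fun u => f u ^+ 2) x
  = 2 * f x * laplacian G1 f x + 2 * grad_normsq G1 f x.
Proof.
rewrite grad_normsqE /laplacian !mulr_sumr -big_split/=; apply: eq_bigr => i _.
rewrite /gradient !mulr_sumr -big_split/=; apply: eq_bigr => j _.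
by rewrite hessian_sqr; ring.
Qed.

End DivGrad.

(** The flow supplies 2 f Lap f + 2 (m2 - 1) |grad f|^2. Trading 2 f Lap f for Lap(f^2) costs 2
    |grad f|^2, which turns the coefficient into 2 m2 - 4. *)
Lemma ricci_rrE x y b c : U x -> V y ->
  - 2 * ricci G (rshift m1 b) (rshift m1 c) (row_mx x y)
  = - 2 * ricci G2 b c y
    + (laplacian G1 (fun u => f u ^+ 2) x
       + (2 * m2%:R - 4) * grad_normsq G1 f x) * G2 y b c.
Proof.
by move=> Ux Vy; rewrite ricci_rr// laplacian_sqr// -grad_normsqE// divgradE//; ring.
Qed.

End WarpedCoordinates.

(** * Smooth functions and coordinate vectors *)

Section SmoothOn.
Context (R : realType) (V : normedModType R).
Implicit Types (f g : V -> R) (O : set V) (x v : V).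

Lemma Ck_on_eq k O f g : open O -> (forall x, O x -> f x = g x) ->
  Ck_on k O f -> Ck_on k O g.
Proof.
move=> oO; elim: k f g => [|k IH] f g fg /=.
  move=> cf x Ox; rewrite /prop_for /continuous_at -fg//.
  apply: cvg_trans (cf x Ox); apply: near_eq_cvg.
  by apply: filterS (open_nbhs_nbhs (conj oO Ox)) => y /fg.
move=> [df Ckdf]; split=> [x Ox|v].
  exact: eq_open_differentiable fg (df x Ox).
apply: IH (Ckdf v) => x Ox; exact: eq_open_derive fg.
Qed.

Lemma Ck_on_sub k O O' f : O' `<=` O -> Ck_on k O f -> Ck_on k O' f.
Proof.
move=> sO; elim: k f => [|k IH] f /=; first by move=> cf x /sO /cf.
by move=> [df Ckdf]; split=> [x /sO /df //|v]; exact: IH.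
Qed.

Lemma Ck_onW k O f : Ck_on k.+1 O f -> Ck_on k O f.
Proof.
elim: k f => [|k IH] f /= [df Ckdf].
  by move=> x Ox; apply: differentiable_continuous; exact: df.
by split=> // v; exact: IH.
Qed.

Lemma Ck_on_cst k O (a : R) : Ck_on k O (fun=> a).
Proof.
elim: k a => [|k IH] a /=; first by move=> x _; exact: cvg_cst.
split=> [x _|v]; first exact: differentiable_constr.
rewrite (_ : (fun x => 'D_v _ x) = fun=> 0); first exact: IH.
by apply/funext => x; exact: derive_cst.
Qed.

Lemma Ck_on_add k O f g : open O -> Ck_on k O f -> Ck_on k O g ->
  Ck_on k O (fun x => f x + g x).
Proof.
move=> oO; elim: k f g => [|k IH] f g /=.
  by move=> cf cg x Ox; apply: cvgD; [exact: cf|exact: cg].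
move=> [df Cf] [dg Cg]; split=> [x Ox|v].
  by apply: differentiable_addr; [exact: df|exact: dg].
apply: (Ck_on_eq oO) (IH _ _ (Cf v) (Cg v)) => x Ox.
by rewrite derive_addr//; [exact: df|exact: dg].
Qed.

Lemma Ck_on_mul k O f g : open O -> Ck_on k O f -> Ck_on k O g ->
  Ck_on k O (fun x => f x * g x).
Proof.
move=> oO; elim: k f g => [|k IH] f g.
  by move=> /= cf cg x Ox; apply: cvgM; [exact: cf|exact: cg].
move=> Cf Cg; have [[df Cdf] [dg Cdg]] := (Cf, Cg).
split=> [x Ox|v]; first by apply: differentiable_mulr; [exact: df|exact: dg].
apply: (Ck_on_eq oO) (Ck_on_add oO (IH _ _ (Ck_onW Cf) (Cdg v))
  (IH _ _ (Cdf v) (Ck_onW Cg))) => x Ox.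
by rewrite derive_mulr//; [exact: df|exact: dg].
Qed.

Lemma smooth_on_differentiable O f x : smooth_on O f -> O x -> differentiable f x.
Proof. by move=> /(_ 1%N) [df _]; exact: df. Qed.

Lemma smooth_on_derive O f v : smooth_on O f -> smooth_on O (fun x => 'D_v f x).
Proof. by move=> sf k; have [_ +] := sf k.+1; apply. Qed.

End SmoothOn.

(** As [phi] is affine with linear part [psi], the derivative of the composite along [v] is again a
    composite with [phi], that of the derivative of [f] along [psi v]. The recursion defining
    [Ck_on] thus closes without a higher-order chain rule. *)
Lemma smooth_on_precomp (R : realType) (V W : normedModType R) (phi psi : V -> W)
    (O : set W) (f : W -> R) :
  (forall (h : R) v x, phi (h *: v + x) = h *: psi v + phi x) ->
  (forall x, differentiable phi x) ->
  smooth_on O f -> smooth_on (phi @^-1` O) (fun x => f (phi x)).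
Proof.
move=> phiE dphi sf k; move: f {sf}(sf k); elim: k => [|k IH] f /=.
  move=> cf x Ox; apply: (@continuous_comp _ _ _ phi f); last exact: cf.
  exact: differentiable_continuous.
move=> [df Cf]; split=> [x Ox|v].
  by apply: (differentiable_comp (g := f)) => //; exact: df.
rewrite (_ : (fun x => _) = fun x => 'D_(psi v) f (phi x)).
  exact: IH (Cf (psi v)).
by apply/funext => x; apply: (@derive_precomp _ _ _ phi psi) => h; exact: phiE.
Qed.

(** * Coordinate vectors as derivations and the Gram matrix of a metric *)

Section Manifold.
Context (R : realType) (M : topologicalType) (n : nat) (A : set (chart R M n))
  (hA : smooth_manifold A).
Implicit Types (f h : M -> R) (p : M) (c d : chart R M n).

Lemma atlas_is_chart c : A c -> is_chart c.
Proof. by have [_ _ + _ _] := hA; apply. Qed.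

Lemma cimg_cinv c x : A c -> cimg c x -> cdom c (cinv c x) /\ cmap c (cinv c x) = x.
Proof.
by move=> /atlas_is_chart [_ _ cmapK _ _] [p cp <-]; rewrite cmapK.
Qed.

Lemma near_cinv c p (P : set M) : A c -> cdom c p -> nbhs p P ->
  \forall x \near cmap c p, P (cinv c x).
Proof.
move=> Ac cp; have [_ _ cmapK _ cinvC] := atlas_is_chart Ac.
have := cinvC (cmap c p) (ex_intro2 _ _ p cp erefl).
by rewrite /prop_for /continuous_at cmapK// => cvgp /cvgp.
Qed.

Lemma smooth_at_near p f h : smooth_at A p f -> (\forall q \near p, f q = h q) ->
  smooth_at A p h.
Proof.
move=> sf fh c Ac cp; have [D [openD Dp sD]] := sf c Ac cp.
have : nbhs (cmap c p) [set x | f (cinv c x) = h (cinv c x)].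
  exact: (near_cinv Ac cp fh).
rewrite nbhsE => -[D' [openD' D'p] D'fh].
exists (D `&` D'); split; [exact: openI|by split|move=> k].
apply: (Ck_on_eq (openI openD openD')) (Ck_on_sub _ (sD k)) => x []// _ D'x.
exact: D'fh.
Qed.

Lemma smooth_at_add p f h : smooth_at A p f -> smooth_at A p h ->
  smooth_at A p (fun q => f q + h q).
Proof.
move=> sf sh c Ac cp; have [D [openD Dp sD]] := sf c Ac cp.
have [D' [openD' D'p sD']] := sh c Ac cp.
exists (D `&` D'); split; [exact: openI|by split|move=> k].
apply: Ck_on_add; first exact: openI.
- by apply: Ck_on_sub (sD k) => x [].
- by apply: Ck_on_sub (sD' k) => x [].
Qed.

Lemma smooth_at_mul p f h : smooth_at A p f -> smooth_at A p h ->
  smooth_at A p (fun q => f q * h q).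
Proof.
move=> sf sh c Ac cp; have [D [openD Dp sD]] := sf c Ac cp.
have [D' [openD' D'p sD']] := sh c Ac cp.
exists (D `&` D'); split; [exact: openI|by split|move=> k].
apply: Ck_on_mul; first exact: openI.
- by apply: Ck_on_sub (sD k) => x [].
- by apply: Ck_on_sub (sD' k) => x [].
Qed.

Lemma smooth_at_cst p (a : R) : smooth_at A p (fun=> a).
Proof.
by move=> c Ac cp; exists setT; split; [exact: openT| |move=> k; exact: Ck_on_cst].
Qed.

(** Read in another chart [d], a coordinate of [c] is a component of a transition map, smooth by the
    definition of the atlas. The work lies in showing that the image of the overlap under [cmap d]
    is open. *)
Lemma smooth_at_coord c p j : A c -> cdom c p ->
  smooth_at A p (fun q => cmap c q ord0 j).
Proof.
move=> Ac cp d Ad dp; exists (cmap d @` (cdom d `&` cdom c)); split.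
- rewrite openE => x [q [dq cq] <-]; have [_ oimg _ _ _] := atlas_is_chart Ad.
  have [oc _ _ _ _] := atlas_is_chart Ac.
  have nc := near_cinv Ad dq (open_nbhs_nbhs (conj oc cq)).
  have nd : nbhs (cmap d q) (cimg d) by apply: open_nbhs_nbhs; split => //; exists q.
  apply: filterS2 nc nd => y cy imy.
  by have [dy dyE] := cimg_cinv Ad imy; exists (cinv d y).
- by exists p.
- by have [_ _ _ _] := hA; apply.
Qed.

Lemma differentiable_cinv c p f : A c -> cdom c p -> smooth_at A p f ->
  differentiable (fun x => f (cinv c x)) (cmap c p).
Proof.
by move=> Ac cp /(_ c Ac cp) [D [_ Dp sD]]; exact: smooth_on_differentiable sD Dp.
Qed.

Lemma coord_vecE c p i f : smooth_at A p f ->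
  coord_vec A c p i f = partial i (fun x => f (cinv c x)) (cmap c p).
Proof. by move=> sf; rewrite /coord_vec asboolT. Qed.

Lemma is_tangent_coord c p i : A c -> cdom c p -> is_tangent A p (coord_vec A c p i).
Proof.
move=> Ac cp; have [_ _ cmapK _ _] := atlas_is_chart Ac; split.
- by move=> f nf; rewrite /coord_vec asboolF.
- move=> f h sf fh; rewrite !coord_vecE//; last exact: smooth_at_near fh.
  by apply: near_eq_derive; exact: (near_cinv Ac cp fh).
- move=> a f h sf sh; have saf : smooth_at A p (fun q => a * f q).
    by apply: smooth_at_mul => //; exact: smooth_at_cst.
  rewrite !coord_vecE//; last exact: smooth_at_add.
  rewrite /partial derive_addr ?derive_cstM//; first exact: differentiable_cinv.
  + exact: differentiable_cinv saf.
  + exact: differentiable_cinv.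
- move=> f h sf sh; rewrite !coord_vecE//; last exact: smooth_at_mul.
  rewrite /partial derive_mulr ?cmapK//; first by rewrite addrC.
  + exact: differentiable_cinv.
  + exact: differentiable_cinv.
Qed.

Lemma is_tangent0 p : is_tangent A p (fun=> 0).
Proof. by split => // *; rewrite ?mulr0 ?mul0r ?addr0. Qed.

Lemma is_tangent_comb p (a : R) u v : is_tangent A p u -> is_tangent A p v ->
  is_tangent A p (fun f => a * u f + v f).
Proof.
move=> [u0 un uD uM] [v0 vn vD vM]; split.
- by move=> f nf; rewrite u0// v0// mulr0 addr0.
- by move=> f h sf fh; rewrite (un _ h)// (vn _ h).
- by move=> b f h sf sh; rewrite uD// vD//; ring.
- by move=> f h sf sh; rewrite uM// vM//; ring.
Qed.

Section Riemannian.
Context (g : metric R M) (hg : riemannian A g).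

Lemma riemannian0l p v : is_tangent A p v -> g p (fun=> 0) v = 0.
Proof.
move=> tv; have [_ gD _ _] := hg.
have := gD p 1 (fun=> 0) (fun=> 0) v (is_tangent0 p) (is_tangent0 p) tv.
rewrite (_ : (fun f => _) = fun=> 0); last by apply/funext => f; rewrite mulr0 addr0.
by rewrite mul1r -[LHS]addr0 => /addrI.
Qed.

Lemma riemannian0r p v : is_tangent A p v -> g p v (fun=> 0) = 0.
Proof.
by move=> tv; have [gC _ _ _] := hg; rewrite gC ?riemannian0l//; exact: is_tangent0.
Qed.

Lemma gcomp_sym c p i j : A c -> cdom c p -> gcomp A g c p i j = gcomp A g c p j i.
Proof.
by move=> Ac cp; have [gC _ _ _] := hg; rewrite !mxE gC//; exact: is_tangent_coord.
Qed.

(** Linearity of the metric is available for tangent vectors only, so tangency of the partial sums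
    is carried along in the same induction. *)
Lemma riemannian_suml p (I : Type) (r : seq I) (a : I -> R) (u : I -> tvec R M) v :
  (forall i, is_tangent A p (u i)) -> is_tangent A p v ->
  is_tangent A p (fun f => \sum_(i <- r) a i * u i f) /\
  g p (fun f => \sum_(i <- r) a i * u i f) v = \sum_(i <- r) a i * g p (u i) v.
Proof.
move=> tu tv; elim: r => [|i r [IHt IHg]].
  rewrite (_ : (fun f => _) = fun=> 0); last by apply/funext => f; rewrite big_nil.
  by rewrite big_nil riemannian0l//; split=> //; exact: is_tangent0.
rewrite (_ : (fun f => _) = fun f => a i * u i f + \sum_(i <- r) a i * u i f).
  split; first exact: is_tangent_comb.
  by have [_ gD _ _] := hg; rewrite gD// IHg big_cons.
by apply/funext => f; rewrite big_cons.
Qed.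

(* A vector a killed by the Gram matrix gives w = sum_i a_i d_i with g(w, w) = 0,
   and a_j is recovered as the derivative along w of the j-th coordinate. *)
Lemma gcomp_unitmx c p : A c -> cdom c p -> gcomp A g c p \in unitmx.
Proof.
move=> Ac cp; have [gC gD gpos _] := hg.
rewrite -row_free_unit -kermx_eq0; apply/rowV0P => a /sub_kermxP aG0.
have tc i : is_tangent A p (coord_vec A c p i) by exact: is_tangent_coord.
pose w : tvec R M := fun f => \sum_i a ord0 i * coord_vec A c p i f.
have tw : is_tangent A p w.
  by have [] := riemannian_suml (index_enum _) (a ord0) tc (is_tangent0 p).
have gw0 : g p w w = 0.
  have [_ ->] := riemannian_suml (index_enum _) (a ord0) tc tw.
  apply: big1 => i _; rewrite gC//.
  have [_ ->] := riemannian_suml (index_enum _) (a ord0) tc (tc i).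
  have := congr1 (fun m : 'rV_n => m ord0 i) aG0; rewrite !mxE => aGi.
  rewrite -[RHS](mulr0 (a ord0 i)); congr (_ * _); rewrite -[RHS]aGi.
  by apply: eq_bigr => j _; rewrite mxE.
have w0 : w = fun=> 0.
  apply: contrapT => wn0; have := gpos p w tw wn0.
  by rewrite gw0 ltxx.
apply/rowP => j; rewrite mxE.
have := congr1 (fun v : tvec R M => v (fun q => cmap c q ord0 j)) w0.
rewrite /w /= => <-.
have sj := smooth_at_coord j Ac cp.
have [_ oimg cmapK _ _] := atlas_is_chart Ac.
pose coord (x : 'rV[R]_n) : R := x ord0 j.
have dcoord i : coord_vec A c p i (fun q => cmap c q ord0 j) = (j == i)%:R.
  rewrite coord_vecE// /partial.
  rewrite (@eq_open_derive _ _ (cimg c) _ coord)//.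
  - rewrite (@derive_precomp _ _ _ coord coord id).
      by rewrite derive_id /coord mxE eqxx.
    by move=> h; rewrite /coord !mxE.
  - by exists p.
  - by move=> x cx; have [_ ->] := cimg_cinv Ac cx.
rewrite (eq_bigr (fun i => (j == i)%:R * a ord0 i)) ?sum_delta// => i _.
by rewrite dcoord mulrC.
Qed.

End Riemannian.

End Manifold.

(** * The warped product *)

Section WarpedProduct.
Context (R : realType) (M1 M2 : topologicalType) (m1 m2 : nat)
  (A1 : set (chart R M1 m1)) (A2 : set (chart R M2 m2))
  (hM1 : smooth_manifold A1) (hM2 : smooth_manifold A2).
Let A := prod_atlas A1 A2.

Lemma smooth_on_lsubmx (D : set 'rV[R]_m1) (f : 'rV[R]_m1 -> R) :
  smooth_on D f ->
  smooth_on ((lsubmx : 'rV[R]_(m1 + m2) -> _) @^-1` D) (fun z => f (lsubmx z)).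
Proof.
apply: (@smooth_on_precomp _ _ _ lsubmx lsubmx) => [h v x|x].
  by rewrite linearP.
exact: differentiable_lsubmx.
Qed.

Lemma smooth_on_rsubmx (D : set 'rV[R]_m2) (f : 'rV[R]_m2 -> R) :
  smooth_on D f ->
  smooth_on ((rsubmx : 'rV[R]_(m1 + m2) -> _) @^-1` D) (fun z => f (rsubmx z)).
Proof.
apply: (@smooth_on_precomp _ _ _ rsubmx rsubmx) => [h v x|x].
  by rewrite linearP.
exact: differentiable_rsubmx.
Qed.

Lemma smooth_at_fst (p : M1 * M2) (f : M1 -> R) :
  smooth_at A1 p.1 f -> smooth_at A p (fun q => f q.1).
Proof.
move=> sf _ [c1 Ac1 [c2 Ac2 ->]] [cp1 cp2].
have [D [openD Dp sD]] := sf c1 Ac1 cp1.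
exists (lsubmx @^-1` D); split.
- by apply: open_comp openD => z _; exact: continuous_lsubmx.
- by rewrite /= row_mxKl.
- exact: smooth_on_lsubmx sD.
Qed.

Lemma smooth_at_snd (p : M1 * M2) (f : M2 -> R) :
  smooth_at A2 p.2 f -> smooth_at A p (fun q => f q.2).
Proof.
move=> sf _ [c1 Ac1 [c2 Ac2 ->]] [cp1 cp2].
have [D [openD Dp sD]] := sf c2 Ac2 cp2.
exists (rsubmx @^-1` D); split.
- by apply: open_comp openD => z _; exact: continuous_rsubmx.
- by rewrite /= row_mxKr.
- exact: smooth_on_rsubmx sD.
Qed.

Section Charts.
Context (c1 : chart R M1 m1) (c2 : chart R M2 m2) (Ac1 : A1 c1) (Ac2 : A2 c2).
Let c := prod_chart c1 c2.

(** The equality is one of functionals on all functions: where [f] is not smooth at [p.1], both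
    sides take the default value 0. Otherwise the projection, read in product coordinates, just
    forgets the second block. *)
Lemma dmap_fst_l p i :
  dmap A1 fst p (coord_vec A c p (lshift m2 i)) = coord_vec A1 c1 p.1 i.
Proof.
apply/funext => f; rewrite /dmap /coord_vec; case: asboolP => // sf.
rewrite asboolT; last exact: smooth_at_fst.
rewrite [LHS]partial_lshift; congr partial.
by apply/funext => u /=; rewrite row_mxKl.
Qed.

Lemma dmap_fst_r p a : dmap A1 fst p (coord_vec A c p (rshift m1 a)) = fun=> 0.
Proof.
apply/funext => f; rewrite /dmap /coord_vec; case: asboolP => // sf.
rewrite asboolT; last exact: smooth_at_fst.
rewrite [LHS]partial_rshift.
rewrite -(partial_const (f (cinv c1 (cmap c1 p.1))) a (cmap c2 p.2)).
by congr partial; apply/funext => u /=; rewrite row_mxKl.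
Qed.

Lemma dmap_snd_r p a :
  dmap A2 snd p (coord_vec A c p (rshift m1 a)) = coord_vec A2 c2 p.2 a.
Proof.
apply/funext => f; rewrite /dmap /coord_vec; case: asboolP => // sf.
rewrite asboolT; last exact: smooth_at_snd.
rewrite [LHS]partial_rshift; congr partial.
by apply/funext => u /=; rewrite row_mxKr.
Qed.

Lemma dmap_snd_l p i : dmap A2 snd p (coord_vec A c p (lshift m2 i)) = fun=> 0.
Proof.
apply/funext => f; rewrite /dmap /coord_vec; case: asboolP => // sf.
rewrite asboolT; last exact: smooth_at_snd.
rewrite [LHS]partial_lshift.
rewrite -(partial_const (f (cinv c2 (cmap c2 p.2))) i (cmap c1 p.1)).
by congr partial; apply/funext => u /=; rewrite row_mxKr.
Qed.

Section Metric.
Context (g1 : metric R M1) (g2 : metric R M2) (lam : M1 -> R)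
  (hg1 : riemannian A1 g1) (hg2 : riemannian A2 g2).

(** Each projection kills the coordinate vectors of the other factor, so in a mixed entry both
    summands of the warped metric have a zero argument. *)
Lemma gcomp_warped x y : cdom c1 x -> cdom c2 y ->
  gcomp A (warped A1 A2 g1 lam g2) c (x, y)
  = block_mx (gcomp A1 g1 c1 x) 0 0 (lam x ^+ 2 *: gcomp A2 g2 c2 y).
Proof.
move=> cx cy; have t1 i := is_tangent_coord hM1 i Ac1 cx.
have t2 a := is_tangent_coord hM2 a Ac2 cy.
have t10 := is_tangent0 A1 x; have t20 := is_tangent0 A2 y.
apply/matrixP => k l.
rewrite [LHS]mxE /warped.
case: (split_ordP k) => i ->; case: (split_ordP l) => j ->.
- rewrite block_mxEul mxE !dmap_fst_l !dmap_snd_l.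
  by rewrite (riemannian0l hg2)// mulr0 addr0.
- rewrite block_mxEur mxE dmap_fst_l dmap_fst_r dmap_snd_l dmap_snd_r.
  by rewrite (riemannian0r hg1)// (riemannian0l hg2)// mulr0 addr0.
- rewrite block_mxEdl mxE dmap_fst_l dmap_fst_r dmap_snd_l dmap_snd_r.
  by rewrite (riemannian0l hg1)// (riemannian0r hg2)// mulr0 addr0.
- rewrite block_mxEdr !mxE !dmap_fst_r !dmap_snd_r.
  by rewrite (riemannian0l hg1)// add0r.
Qed.

Lemma gloc_warped x y : cimg c1 x -> cimg c2 y ->
  gloc A (warped A1 A2 g1 lam g2) c (row_mx x y)
  = block_mx (gloc A1 g1 c1 x) 0 0 (lam (cinv c1 x) ^+ 2 *: gloc A2 g2 c2 y).
Proof.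
move=> cx cy; rewrite /gloc /= row_mxKl row_mxKr.
have [dx _] := cimg_cinv hM1 Ac1 cx; have [dy _] := cimg_cinv hM2 Ac2 cy.
exact: gcomp_warped.
Qed.

End Metric.
End Charts.
End WarpedProduct.

(** * Metric components and the warping function at a fixed time *)

Section LocalMetric.
Context (R : realType) (M : topologicalType) (n : nat) (A : set (chart R M n))
  (hA : smooth_manifold A) (g : metric R M) (hg : riemannian A g)
  (c : chart R M n) (Ac : A c).

Lemma gloc_unitmx x : cimg c x -> gloc A g c x \in unitmx.
Proof.
by move=> cx; have [dx _] := cimg_cinv hA Ac cx; exact: (gcomp_unitmx hA).
Qed.

Lemma gloc_sym x i j : cimg c x -> gloc A g c x i j = gloc A g c x j i.
Proof.
by move=> cx; have [dx _] := cimg_cinv hA Ac cx; exact: (gcomp_sym hA).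
Qed.

Lemma gloc_differentiable x i j : cimg c x ->
  differentiable (fun u => gloc A g c u i j) x.
Proof.
by move=> cx; have [_ _ _ sg] := hg; exact: smooth_on_differentiable (sg c i j Ac) cx.
Qed.

End LocalMetric.

(** The local space-time extension is restricted to the slice at time [t] by an affine map. On the
    open chart image this slice agrees with [f t] itself, so smoothness in space is genuine even at
    the boundary time 0. *)
Lemma smooth_fun_family_at (R : realType) (M : topologicalType) (n : nat)
    (A : set (chart R M n)) (T : \bar R) (f : R -> M -> R) (t : R)
    (c : chart R M n) x :
  smooth_manifold A -> smooth_fun_family A T f -> time_interval T t -> A c ->
  cimg c x ->
  exists D, [/\ open D, D x & smooth_on D (fun u => f t (cinv c u))].
Proof.
move=> hA sf Tt Ac cx.
have [W [F [openW Wx sF Ff]]] := sf c Ac (x, t) (conj cx Tt).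
have [_ openc _ _ _] := atlas_is_chart hA Ac.
pose phi (u : 'rV[R]_n) : 'rV[R]_n * R := (u, t).
have dphi u : differentiable phi u.
  by apply: differentiable_pair => //; exact: differentiable_cst.
have openpW : open (phi @^-1` W).
  by apply: open_comp openW => u _; exact: differentiable_continuous.
exists (phi @^-1` W `&` cimg c); split => //; first exact: openI.
move=> k; apply: (Ck_on_eq (f := fun u => F (phi u))); first exact: openI.
  by move=> u [Wu cu]; exact: Ff.
apply: (@Ck_on_sub _ _ _ (phi @^-1` W)); first by move=> u [].
apply: (@smooth_on_precomp _ _ _ phi (fun v => (v, 0))) => // h v u.
by rewrite /phi; congr (_, _); rewrite /= scaler0 add0r.
Qed.

(** The limit is taken within the time interval, so agreement there suffices; [t] must lie in it
    too, as the difference quotient also involves the value at [t]. *)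
Lemma eq_has_time_derivative (R : realType) (T : \bar R) (f g : R -> R) (t l : R) :
  time_interval T t -> (forall s, time_interval T s -> f s = g s) ->
  has_time_derivative T f t l -> has_time_derivative T g t l.
Proof.
move=> Tt fg; apply: cvg_trans; apply: near_eq_cvg.
apply: filterS (withinT (time_interval T) (dnbhs_filter t)) => s Ts.
by rewrite !fg.
Qed.

Theorem proposition5p1 (R : realType) (M1 M2 : topologicalType) (m1 m2 : nat)
    (A1 : set (chart R M1 m1)) (A2 : set (chart R M2 m2)) (T : \bar R)
    (g1 : R -> metric R M1) (g2 : R -> metric R M2) (lam : R -> M1 -> R)
    (hM1 : smooth_manifold A1) (hM2 : smooth_manifold A2) (hm2 : (2 <= m2)%N)
    (hT : (0 < T)%E)
    (hg1 : forall t, time_interval T t -> riemannian A1 (g1 t))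
    (hg2 : forall t, time_interval T t -> riemannian A2 (g2 t))
    (hlam_gt0 : forall t x, time_interval T t -> 0 < lam t x)
    (hlam : smooth_fun_family A1 T lam)
    (hsmooth : smooth_metric_family (prod_atlas A1 A2) T
                 (fun t => warped A1 A2 (g1 t) (lam t) (g2 t)))
    (hflow : ricci_flow (prod_atlas A1 A2) T
               (fun t => warped A1 A2 (g1 t) (lam t) (g2 t))) :
  (forall (c1 : chart R M1 m1) (x : M1) (t : R) (i j : 'I_m1),
     A1 c1 -> cdom c1 x -> time_interval T t ->
     has_time_derivative T (fun s => gcomp A1 (g1 s) c1 x i j) t
       (- 2 * Ric A1 (g1 t) c1 x i j
        + 2 * m2%:R / lam t x * Hess A1 (g1 t) c1 x (lam t) i j)) /\
  (forall (c1 : chart R M1 m1) (c2 : chart R M2 m2) (x : M1) (y : M2) (t : R)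
          (a b : 'I_m2),
     A1 c1 -> cdom c1 x -> A2 c2 -> cdom c2 y -> time_interval T t ->
     has_time_derivative T
       (fun s => lam s x ^+ 2 * gcomp A2 (g2 s) c2 y a b) t
       (- 2 * Ric A2 (g2 t) c2 y a b
        + (Laplacian A1 (g1 t) c1 x (fun z => lam t z ^+ 2)
           + (2 * m2%:R - 4) * GradNormSq A1 (g1 t) c1 x (lam t))
          * gcomp A2 (g2 t) c2 y a b)).

Proof.
pose A := prod_atlas A1 A2.
pose g t := warped A1 A2 (g1 t) (lam t) (g2 t).
have gcompE c1 c2 x y s : A1 c1 -> A2 c2 -> cdom c1 x -> cdom c2 y ->
    time_interval T s -> gcomp A (g s) (prod_chart c1 c2) (x, y)
      = block_mx (gcomp A1 (g1 s) c1 x) 0 0 (lam s x ^+ 2 *: gcomp A2 (g2 s) c2 y).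
  move=> Ac1 Ac2 cx cy Ts.
  by apply: gcomp_warped => //; [exact: hg1|exact: hg2].
have flow c1 c2 x y t k l : A1 c1 -> A2 c2 -> cdom c1 x -> cdom c2 y ->
    time_interval T t ->
    has_time_derivative T (fun s => gcomp A (g s) (prod_chart c1 c2) (x, y) k l) t
      (- 2 * ricci (gloc A (g t) (prod_chart c1 c2)) k l
               (row_mx (cmap c1 x) (cmap c2 y))).
  move=> Ac1 Ac2 cx cy Tt.
  by apply: hflow => //; exists c1 => //; exists c2.
have difflam t c1 x : time_interval T t -> A1 c1 -> cimg c1 x ->
    differentiable (fun u => lam t (cinv c1 u)) x /\
    forall i, differentiable (partial i (fun u => lam t (cinv c1 u))) x.
  move=> Tt Ac1 cx; have [D [_ Dx sD]] := smooth_fun_family_at hM1 hlam Tt Ac1 cx.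
  split=> [|i]; first exact: smooth_on_differentiable sD Dx.
  exact: smooth_on_differentiable (smooth_on_derive _ sD) Dx.
have ric c1 c2 x y t : A1 c1 -> A2 c2 -> cdom c1 x -> cdom c2 y ->
    time_interval T t ->
    let ric k l := - 2 * ricci (gloc A (g t) (prod_chart c1 c2)) k l
                           (row_mx (cmap c1 x) (cmap c2 y)) in
    (forall i j, ric (lshift m2 i) (lshift m2 j)
       = - 2 * Ric A1 (g1 t) c1 x i j
         + 2 * m2%:R / lam t x * Hess A1 (g1 t) c1 x (lam t) i j) /\
    (forall a b, ric (rshift m1 a) (rshift m1 b)
       = - 2 * Ric A2 (g2 t) c2 y a b
         + (Laplacian A1 (g1 t) c1 x (fun z => lam t z ^+ 2)
            + (2 * m2%:R - 4) * GradNormSq A1 (g1 t) c1 x (lam t))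
           * gcomp A2 (g2 t) c2 y a b).
  move=> Ac1 Ac2 cx cy Tt /=.
  have [_ o1 K1 _ _] := atlas_is_chart hM1 Ac1.
  have [_ o2 K2 _ _] := atlas_is_chart hM2 Ac2.
  have ix : cimg c1 (cmap c1 x) by exists x.
  have iy : cimg c2 (cmap c2 y) by exists y.
  have gE u v : cimg c1 u -> cimg c2 v ->
      gloc A (g t) (prod_chart c1 c2) (row_mx u v)
      = block_mx (gloc A1 (g1 t) c1 u) 0 0
          (lam t (cinv c1 u) ^+ 2 *: gloc A2 (g2 t) c2 v).
    by move=> cu cv; apply: gloc_warped => //; [exact: hg1|exact: hg2].
  have u1 u := gloc_unitmx hM1 (hg1 t Tt) Ac1 (x := u).
  have u2 v := gloc_unitmx hM2 (hg2 t Tt) Ac2 (x := v).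
  have s1 u i j := gloc_sym hM1 (hg1 t Tt) Ac1 (x := u) i j.
  have s2 v a b := gloc_sym hM2 (hg2 t Tt) Ac2 (x := v) a b.
  have d1 u i j := gloc_differentiable (hg1 t Tt) Ac1 (x := u) i j.
  have d2 v a b := gloc_differentiable (hg2 t Tt) Ac2 (x := v) a b.
  have l0 u (_ : cimg c1 u) : lam t (cinv c1 u) != 0 by rewrite gt_eqF// hlam_gt0.
  have dl u (cu : cimg c1 u) := (difflam t c1 u Tt Ac1 cu).1.
  have ddl u i (cu : cimg c1 u) := (difflam t c1 u Tt Ac1 cu).2 i.
  split=> [i j|a b].
  - rewrite (ricci_ll o1 o2 u1 u2 s2 d2 l0 dl ddl gE)//.
    by rewrite K1// /Ric /Hess; ring.
  - rewrite (ricci_rrE o1 o2 u1 u2 s1 s2 d1 d2 l0 dl ddl gE)//.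
    by rewrite /gloc K2.
have [[y0 _] _ _ cover2 _] := hM2.
split=> [c1 x t i j Ac1 cx Tt|c1 c2 x y t a b Ac1 cx Ac2 cy Tt].
(* The first equation does not mention the second factor; any point of the nonempty [M2] provides a
   product chart whose upper left block gives it. *)
- have [c2 Ac2 cy] := cover2 y0.
  have [<- _] := ric _ _ _ _ _ Ac1 Ac2 cx cy Tt.
  apply: eq_has_time_derivative Tt _ (flow _ _ _ _ _ _ _ Ac1 Ac2 cx cy Tt) => s Ts.
  by rewrite gcompE// block_mxEul.
(* The lower right block of the metric is already lambda^2 g2, so its time derivative is never split
   into those of lambda and g2. *)
- have [_ <-] := ric _ _ _ _ _ Ac1 Ac2 cx cy Tt.
  apply: eq_has_time_derivative Tt _ (flow _ _ _ _ _ _ _ Ac1 Ac2 cx cy Tt) => s Ts.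
  by rewrite gcompE// block_mxEdr mxE.
Qed.
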